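(* Let $f:\mathbb{R}^n\to\mathbb{R}$ be continuously differentiable with $L$-Lipschitz continuous gradient ($L>0$), and suppose there is $f_{\rm low}\in\mathbb{R}$ with $f(\boldsymbol{x})\ge f_{\rm low}$ for all $\boldsymbol{x}\in\mathbb{R}^n$. Let $\eta,\sigma,P_{\max}>0$, $\kappa\in(0,1]$, $D_{\max}>1$, $p,q\in(0,1]$. Suppose that the random sequences $\{\mathcal{D}_k\}_k$ and $\{\boldsymbol{P}_k\}_k$ generated by the direct-search algorithm in reduced spaces are $(\kappa,D_{\max},p)$-descent and $(\eta,\sigma,P_{\max},q)$-well-aligned, respectively. Define $$\bar\alpha:=\frac{2\kappa\eta}{(L+c)P_{\max}^2D_{\max}^3},\quad \beta:=\frac{2D_{\max}^2(f(\boldsymbol{x}_0)-f_{\rm low})}{c\,\sigma^2},\quad \mu:=\log_{\gamma_{\rm inc}}(\gamma_{\rm dec}^{-1}),$$ $$C:=\frac{(\mu\gamma_{\rm dec}^2+\gamma_{\rm inc}^2)\gamma_{\rm inc}^2\beta}{\mu\gamma_{\rm dec}^4},\qquad p_0:=\max\left\{\frac{1}{1+\mu},\frac{\mu}{1+\mu}\right\}.$$ Suppose further that $pq>p_0$, and consider an index $k$ and a tolerance $\epsilon>0$ such that $$k\ \ge\ \frac{2}{pq-p_0}\left[\frac{(1-p_0)C}{\bar\alpha^2}\epsilon^{-2}+(1-p_0)\log_{\gamma_{\rm dec}}\left(\frac{\gamma_{\rm dec}^2\bar\alpha}{\gamma_{\rm inc}\alpha_0}\epsilon\right)\right]\quad\text{and}\quad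 \epsilon\le\min\left\{1,\frac{\gamma_{\rm inc}^{-1}\alpha_0}{\bar\alpha}\right\}.$$ Then, with $\tilde G_k:=\min_{0\le j\le k-1}\|\nabla f(\boldsymbol{x}_j)\|$ (a random variable), $$\mathbb{P}\left(\tilde G_k\le\epsilon\right)\ \ge\ 1-\exp\left[-\frac{(pq-p_0)^2}{8pq}\,k\right].$$
   Context: $\|\cdot\|$ is the Euclidean norm for vectors and the operator 2-norm for matrices; $\log_a$ is the base-$a$ logarithm. Direct-search algorithm in reduced spaces. Inputs: $\boldsymbol{x}_0\in\mathbb{R}^n$, $\alpha_{\max}>0$, $\alpha_0\in(0,\alpha_{\max}]$, $c>0$, $0<\gamma_{\rm dec}<1<\gamma_{\rm inc}$, integers $m\ge1$ and $1\le r\le n$. For $k=0,1,\dots$: compute a matrix $\boldsymbol{P}_k\in\mathbb{R}^{r\times n}$ and a set $\mathcal{D}_k\subset\mathbb{R}^r$ of $m$ vectors. If there exists $\boldsymbol{d}_k\in\mathcal{D}_k$ such that $f(\boldsymbol{x}_k+\alpha_k\boldsymbol{P}_k^{\rm T}\boldsymbol{d}_k)<f(\boldsymbol{x}_k)-\frac c2\alpha_k^2\|\boldsymbol{P}_k^{\rm T}\boldsymbol{d}_k\|^2$, set $\boldsymbol{x}_{k+1}:=\boldsymbol{x}_k+\alpha_k\boldsymbol{P}_k^{\rm T}\boldsymbol{d}_k$ and $\alpha_{k+1}:=\min\{\gamma_{\rm inc}\alpha_k,\alpha_{\max}\}$. Otherwise set $\boldsymbol{x}_{k+1}:=\boldsymbol{x}_k$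 and $\alpha_{k+1}:=\gamma_{\rm dec}\alpha_k$. The matrices $\boldsymbol{P}_k$ and the sets $\mathcal{D}_k$ are random; they are the source of randomness in the algorithm. $\boldsymbol{P}_k$ is $(\eta,\sigma,P_{\max})$-well aligned (for $f$ at $\boldsymbol{x}_k$) if $\|\boldsymbol{P}_k\nabla f(\boldsymbol{x}_k)\|\ge\eta\|\nabla f(\boldsymbol{x}_k)\|$, $\|\boldsymbol{P}_k\|\le P_{\max}$ and $\sigma_{\min}(\boldsymbol{P}_k)\ge\sigma$, where $\sigma_{\min}(\boldsymbol{P}_k)$ denotes the minimum nonzero singular value of $\boldsymbol{P}_k$. $\mathcal{D}_k$ is $(\kappa,D_{\max})$-descent (for $f$ and $\boldsymbol{P}_k$ at $\boldsymbol{x}_k$) if $\max_{\boldsymbol{d}\in\mathcal{D}_k}\frac{-\boldsymbol{d}^{\rm T}\boldsymbol{P}_k\nabla f(\boldsymbol{x}_k)}{\|\boldsymbol{d}\|\,\|\boldsymbol{P}_k\nabla f(\boldsymbol{x}_k)\|}\ge\kappa$ and $D_{\max}^{-1}\le\|\boldsymbol{d}\|\le D_{\max}$ for all $\boldsymbol{d}\in\mathcal{D}_k$. Let $\mathcal{F}_{k-1}$ be the $\sigma$-algebra generated by $\boldsymbol{P}_0,\mathcal{D}_0,\dots,\boldsymbol{P}_{k-1},\mathcal{D}_{k-1}$ (trivial for $k=0$) and $\mathcal{F}_{k-1/2}$ the one generated by $\boldsymbol{P}_0,\mathcal{D}_0,\dots,\boldsymbol{P}_{k-1},\mathcal{D}_{k-1},\boldsymbol{P}_k$.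 The sequence $\{\boldsymbol{P}_k\}_k$ is $(\eta,\sigma,P_{\max},q)$-well-aligned if $\mathbb{P}(\boldsymbol{P}_k\text{ is }(\eta,\sigma,P_{\max})\text{-well aligned}\mid\mathcal{F}_{k-1})\ge q$ for all $k\ge0$. The sequence $\{\mathcal{D}_k\}_k$ is $(\kappa,D_{\max},p)$-descent if $\mathbb{P}(\mathcal{D}_k\text{ is }(\kappa,D_{\max})\text{-descent}\mid\mathcal{F}_{k-1/2})\ge p$ for all $k\ge0$.
   Formalization: σ_min(P_k) is taken as the smallest of all r singular values of P_k, zero included, so well-aligned matrices must have full row rank; with the minimum nonzero singular value the claim fails for rank-deficient P_k, e.g. P_k = diag(1,0). *)

(* Defs.v *)
From HB Require Import structures.
From mathcomp Require Import all_boot all_order all_algebra.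
From mathcomp Require Import all_classical all_reals all_analysis.
Set Implicit Arguments.
Unset Strict Implicit.
Unset Printing Implicit Defensive.
Import Order.TTheory GRing.Theory Num.Theory.
Import numFieldNormedType.Exports.
Local Open Scope classical_set_scope.
Local Open Scope ring_scope.

Section Euclidean.
Context {R : realType}.

(* The norm `|x| of the library on matrices is the max norm, hence the
   explicit Euclidean norm and operator 2-norm. *)
Definition dot n (u v : 'cV[R]_n) : R := \sum_(i < n) u i 0 * v i 0.

Definition norm2 n (u : 'cV[R]_n) : R := Num.sqrt (dot u u).

Definition opnorm2 r n (A : 'M[R]_(r, n)) : R :=
  sup [set norm2 (A *m u) | u in [set u : 'cV[R]_n | norm2 u <= 1]].

(* For r <= n, an r x n matrix A has r singular values, the square roots of
   the eigenvalues of the r x r matrix A *m A^T; the n - r further zero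
   eigenvalues of A^T *m A are not counted. *)
Definition singular_value r n (A : 'M[R]_(r, n)) (s : R) : Prop :=
  0 <= s /\ eigenvalue (A *m A^T) (s ^+ 2).

(* Smallest of these r singular values. It is the smallest nonzero one when A
   has full row rank and 0 otherwise, so that sigma_min A bounds
   norm2 (A^T *m d) / norm2 d from below. Restricting the infimum to positive
   singular values would lose this bound for rank-deficient A, and the
   complexity result would then be false. *)
Definition sigma_min r n (A : 'M[R]_(r, n)) : R :=
  inf [set s | singular_value A s].

Definition gradient n (f : 'cV[R]_n -> R) (x : 'cV[R]_n) : 'cV[R]_n :=
  \col_i 'D_(delta_mx i 0) f x.

Definition log_base (a x : R) : R := ln x / ln a.

End Euclidean.

Section DirectSearch.
Context {R : realType}.
Variables (n r m : nat) (f : 'cV[R]_n -> R).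

Definition well_aligned (eta sigma Pmax : R) (x : 'cV[R]_n)
    (P : 'M[R]_(r, n)) : Prop :=
  [/\ eta * norm2 (gradient f x) <= norm2 (P *m gradient f x),
      opnorm2 P <= Pmax & sigma <= sigma_min P].

(* Cosine of the angle between d and - v. It is undefined for v = 0; the value
   1 makes the cosine condition in [descent_set] hold there. *)
Definition descent_cos (v d : 'cV[R]_r) : R :=
  if v == 0 then 1 else - dot d v / (norm2 d * norm2 v).

(* A cosine is at least -1, so the base value -1 does not affect the maximum
   when 0 < m. *)
Definition descent_set (kappa Dmax : R) (x : 'cV[R]_n) (P : 'M[R]_(r, n))
    (D : 'I_m -> 'cV[R]_r) : Prop :=
  kappa <= \big[Num.max/-1]_(i < m) descent_cos (P *m gradient f x) (D i) /\
  forall i : 'I_m, Dmax^-1 <= norm2 (D i) <= Dmax.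

Definition sufficient_decrease (c a : R) (x s : 'cV[R]_n) : Prop :=
  f (x + a *: s) < f x - c / 2 * a ^+ 2 * norm2 s ^+ 2.

(* (x, alpha) is a possible output of the algorithm on the realizations P, D;
   any polling direction giving sufficient decrease may be selected. *)
Definition direct_search (x0 : 'cV[R]_n) (amax a0 c gdec ginc : R)
    (P : nat -> 'M[R]_(r, n)) (D : nat -> 'I_m -> 'cV[R]_r)
    (x : nat -> 'cV[R]_n) (alpha : nat -> R) : Prop :=
  [/\ x 0%N = x0, alpha 0%N = a0 &
   forall k,
     (exists i : 'I_m,
       [/\ sufficient_decrease c (alpha k) (x k) ((P k)^T *m D k i),
           x k.+1 = x k + alpha k *: ((P k)^T *m D k i) &
           alpha k.+1 = Num.min (ginc * alpha k) amax]) \/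
     [/\ forall i : 'I_m,
           ~ sufficient_decrease c (alpha k) (x k) ((P k)^T *m D k i),
         x k.+1 = x k &
         alpha k.+1 = gdec * alpha k]].

End DirectSearch.

Section Randomness.
Context {R : realType} {d : measure_display} {Omega : measurableType d}.

(* Generators of the sigma-algebra of a random matrix: the preimages of Borel
   sets by its entries. *)
Definition entry_events a b (X : Omega -> 'M[R]_(a, b)) : set (set Omega) :=
  [set A | exists i j (B : set R),
     measurable B /\ A = (fun w => X w i j) @^-1` B].

Definition random_matrix a b (X : Omega -> 'M[R]_(a, b)) : Prop :=
  entry_events X `<=` d.-measurable.

Definition measurable_wrt a b (F : set (set Omega))
    (X : Omega -> 'M[R]_(a, b)) : Prop := entry_events X `<=` F.

(* [past_events P D k] generates F_(k-1), and [half_sigma P D k] is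
   F_(k-1/2). *)
Definition past_events n r m (P : nat -> Omega -> 'M[R]_(r, n))
    (D : nat -> Omega -> 'I_m -> 'cV[R]_r) (k : nat) : set (set Omega) :=
  \bigcup_(j in [set j | (j < k)%N])
    (entry_events (P j) `|`
     \bigcup_(i in [set: 'I_m]) entry_events (fun w => D j w i)).

Definition past_sigma n r m (P : nat -> Omega -> 'M[R]_(r, n))
    (D : nat -> Omega -> 'I_m -> 'cV[R]_r) (k : nat) : set (set Omega) :=
  <<s past_events P D k >>.

Definition half_sigma n r m (P : nat -> Omega -> 'M[R]_(r, n))
    (D : nat -> Omega -> 'I_m -> 'cV[R]_r) (k : nat) : set (set Omega) :=
  <<s past_events P D k `|` entry_events (P k) >>.

(* g is a version of the conditional probability of A given the sub-sigma-
   algebra F, i.e. of the conditional expectation of the indicator of A. *)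
Definition is_cond_prob (Pr : probability Omega R) (F : set (set Omega))
    (A : set Omega) (g : Omega -> R) : Prop :=
  [/\ d.-measurable A,
      forall B : set R, measurable B -> F (g @^-1` B),
      Pr.-integrable [set: Omega] (EFin \o g) &
      forall E, F E -> (\int[Pr]_(w in E) (g w)%:E = Pr (A `&` E))%E].

(* Versions are almost surely equal, so it does not matter which one is
   used. *)
Definition cond_prob_ge (Pr : probability Omega R) (F : set (set Omega))
    (A : set Omega) (q : R) : Prop :=
  exists2 g, is_cond_prob Pr F A g & {ae Pr, forall w, q <= g w}.

Definition well_aligned_seq n r m (Pr : probability Omega R)
    (f : 'cV[R]_n -> R) (eta sigma Pmax q : R)
    (P : nat -> Omega -> 'M[R]_(r, n))
    (D : nat -> Omega -> 'I_m -> 'cV[R]_r)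
    (x : nat -> Omega -> 'cV[R]_n) : Prop :=
  forall k, cond_prob_ge Pr (past_sigma P D k)
    [set w | well_aligned f eta sigma Pmax (x k w) (P k w)] q.

Definition descent_seq n r m (Pr : probability Omega R)
    (f : 'cV[R]_n -> R) (kappa Dmax p : R)
    (P : nat -> Omega -> 'M[R]_(r, n))
    (D : nat -> Omega -> 'I_m -> 'cV[R]_r)
    (x : nat -> Omega -> 'cV[R]_n) : Prop :=
  forall k, cond_prob_ge Pr (half_sigma P D k)
    [set w | descent_set f kappa Dmax (x k w) (P k w) (D k w)] p.

End Randomness.

(* Main.v *)
Require Import Defs.
From HB Require Import structures.
From mathcomp Require Import all_boot all_order all_algebra.
From mathcomp Require Import all_classical all_reals all_analysis.
From mathcomp Require Import measurable_realfun.
From mathcomp Require Import ring lra.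
Import Order.TTheory GRing.Theory Num.Theory.
Import numFieldNormedType.Exports.
Local Open Scope classical_set_scope.
Local Open Scope ring_scope.

(** Call iteration j good when the subspace matrix is well aligned and the
    polling set is a descent set. The result balances two estimates of the
    number of good iterations among the first k.

    Upper bound, on every trajectory. As long as the gradient norm exceeds
    eps, a good iteration whose step size is at most e := abar * eps must
    succeed: otherwise the angle condition, the quadratic upper bound on f and
    the failed decrease test contradict each other
    ([small_step_sufficient_decrease]). On the logarithmic scale
    tau := log alpha a success adds 1 to tau (up to the cap) and a failure
    subtracts mu. A good failure, which happens only above log e, uses up mu
    units of earlier rise, and a good success with a small step makes up for
    one of the mu units lost in an earlier bad failure. A good success with a
    large step decreases f by a fixed amount, which can happen only a bounded
    number of times because f is bounded below. Hence, up to a constant,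
    there are at most max (mu, 1 / mu) good iterations for each bad one, that is
    a proportion p0. One potential function does the whole bookkeeping
    ([potential_step]), and telescoping it bounds the number of good iterations
    by p0 * k plus an explicit constant ([good_iterations_le],
    [iteration_budget]). The lower bound on k makes this at most
    (p * q + p0) / 2 * k.

    Lower bound, in probability. Given the past, each iteration is good with
    probability at least p * q ([good_event_hit]), so the number of good
    iterations has the lower tail of a binomial variable, by the exponential
    moment method ([hit_count_chernoff]). Having at most
    (p * q + p0) / 2 * k good iterations therefore has probability at most
    exp (- (p * q - p0) ^ 2 / (8 * p * q) * k), and this event contains the one
    where all k gradient norms exceed eps. *)

(** * Euclidean norm, operator norm and smallest singular value *)

Section EuclideanTheory.
Set Implicit Arguments.
Unset Strict Implicit.
Context {R : realType}.

Lemma dotE n (u v : 'cV[R]_n) : dot u v = (u^T *m v) 0 0.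
Proof. by rewrite mxE; apply: eq_bigr => i _; rewrite mxE. Qed.

Lemma dotC n (u v : 'cV[R]_n) : dot u v = dot v u.
Proof. by apply: eq_bigr => i _; rewrite mulrC. Qed.

Lemma dotDr n (u v w : 'cV[R]_n) : dot u (v + w) = dot u v + dot u w.
Proof. by rewrite !dotE mulmxDr mxE. Qed.

Lemma dotZr n (a : R) (u v : 'cV[R]_n) : dot u (a *: v) = a * dot u v.
Proof. by rewrite !dotE -scalemxAr mxE. Qed.

Lemma dotDl n (u v w : 'cV[R]_n) : dot (u + v) w = dot u w + dot v w.
Proof. by rewrite dotC dotDr !(dotC w). Qed.

Lemma dotZl n (a : R) (u v : 'cV[R]_n) : dot (a *: u) v = a * dot u v.
Proof. by rewrite dotC dotZr dotC. Qed.

Lemma dotBl n (u v w : 'cV[R]_n) : dot (u - v) w = dot u w - dot v w.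
Proof. by rewrite dotDl -scaleN1r dotZl mulN1r. Qed.

Lemma dotBr n (u v w : 'cV[R]_n) : dot u (v - w) = dot u v - dot u w.
Proof. by rewrite dotC dotBl !(dotC u). Qed.

Lemma dot_mulmxl a b (A : 'M[R]_(a, b)) u v :
  dot (A *m u) v = dot u (A^T *m v).
Proof. by rewrite !dotE trmx_mul mulmxA. Qed.

Lemma dot_ge0 n (u : 'cV[R]_n) : 0 <= dot u u.
Proof. by apply: sumr_ge0 => i _; rewrite -expr2 sqr_ge0. Qed.

Lemma dot_eq0 n (u : 'cV[R]_n) : (dot u u == 0) = (u == 0).
Proof.
apply/eqP/eqP => [u0|->]; last by rewrite /dot big1// => i _; rewrite mxE mul0r.
apply/matrixP => i j; rewrite ord1 mxE; apply/eqP; rewrite -sqrf_eq0 expr2.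
by move/psumr_eq0P: u0 => ->// k _; rewrite -expr2 sqr_ge0.
Qed.

Lemma dot0l n (v : 'cV[R]_n) : dot 0 v = 0.
Proof. by rewrite -[X in dot X _](scale0r 0) dotZl mul0r. Qed.

Lemma norm2_ge0 n (u : 'cV[R]_n) : 0 <= norm2 u.
Proof. exact: sqrtr_ge0. Qed.

Lemma sqr_norm2 n (u : 'cV[R]_n) : norm2 u ^+ 2 = dot u u.
Proof. by rewrite sqr_sqrtr ?dot_ge0. Qed.

Lemma norm2_eq0 n (u : 'cV[R]_n) : (norm2 u == 0) = (u == 0).
Proof. by rewrite -sqrf_eq0 sqr_norm2 dot_eq0. Qed.

Lemma norm20 n : norm2 (0 : 'cV[R]_n) = 0.
Proof. by apply/eqP; rewrite norm2_eq0. Qed.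

Lemma norm2_gt0 n (u : 'cV[R]_n) : (0 < norm2 u) = (u != 0).
Proof. by rewrite lt_def norm2_ge0 andbT norm2_eq0. Qed.

Lemma norm2Z n (a : R) (u : 'cV[R]_n) : norm2 (a *: u) = `|a| * norm2 u.
Proof.
by rewrite /norm2 dotZl dotZr mulrA -expr2 sqrtrM ?sqr_ge0// sqrtr_sqr.
Qed.

(** For c > 0 evaluate at the minimizer - b / c; for c = 0 a nonzero slope b
    would make the affine function negative somewhere. *)
Lemma discriminant_le0 (a b c : R) : 0 <= c ->
  (forall t, 0 <= a + 2 * t * b + t ^+ 2 * c) -> b ^+ 2 <= a * c.
Proof.
move=> c0 h; have [c_eq0|c_neq0] := eqVneq c 0.
  suff -> : b = 0 by rewrite c_eq0 mulr0 expr0n.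
  apply/eqP/negP => /negP b0; have := h (- (a + 1) / (2 * b)).
  rewrite c_eq0 mulr0 addr0 leNgt => /negP; apply.
  have -> : a + 2 * (- (a + 1) / (2 * b)) * b = -1 by field.
  by rewrite ltrN10.
have {c_neq0}c_gt0 : 0 < c by rewrite lt_def c_neq0.
have := h (- b / c); rewrite -(pmulr_rge0 _ c_gt0).
have -> : c * (a + 2 * (- b / c) * b + (- b / c) ^+ 2 * c) = a * c - b ^+ 2.
  by field; rewrite gt_eqF.
by rewrite subr_ge0.
Qed.

(** For a general positive semidefinite form, because besides the dot product
    it is needed for a shifted Gram matrix in [sym_nonsingular_form_ge]. *)
Lemma cauchy_schwarz_form n (B : 'M[R]_n) : B^T = B ->
  (forall u, 0 <= dot u (B *m u)) -> forall u v,
  dot u (B *m v) ^+ 2 <= dot u (B *m u) * dot v (B *m v).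
Proof.
move=> symB B0 u v; apply: discriminant_le0 => // t.
have -> : dot u (B *m u) + 2 * t * dot u (B *m v) + t ^+ 2 * dot v (B *m v) =
    dot (u + t *: v) (B *m (u + t *: v)).
  rewrite mulmxDr -scalemxAr !(dotDl, dotDr, dotZl, dotZr).
  by rewrite (dotC v (B *m u)) dot_mulmxl symB; ring.
exact: B0.
Qed.

Lemma cauchy_schwarz n (u v : 'cV[R]_n) : dot u v <= norm2 u * norm2 v.
Proof.
have := @cauchy_schwarz_form n 1%:M (trmx1 _ _).
have B0 (w : 'cV[R]_n) : 0 <= dot w (1%:M *m w) by rewrite mul1mx; exact: dot_ge0.
move=> /(_ B0 u v); rewrite !mul1mx -!sqr_norm2 -exprMn => uv.
apply: le_trans (ler_norm _) _.
by rewrite -(ler_pXn2r (n := 2)) ?nnegrE ?mulr_ge0 ?norm2_ge0// real_normK ?num_real.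
Qed.

(** Makes the supremum defining the operator norm finite; the constant is the
    Frobenius norm. *)
Lemma mulmx_bounded a b (A : 'M[R]_(a, b)) :
  exists2 K, 0 <= K & forall u, norm2 (A *m u) <= K * norm2 u.
Proof.
pose S := \sum_i dot (row i A)^T (row i A)^T.
have S0 : 0 <= S by apply: sumr_ge0 => i _; exact: dot_ge0.
exists (Num.sqrt S); first exact: sqrtr_ge0.
move=> u; rewrite /norm2 -sqrtrM// ler_wsqrtr// mulr_suml; apply: ler_sum => i _.
have -> : (A *m u) i 0 = dot (row i A)^T u.
  by rewrite mxE /dot; apply: eq_bigr => j _; rewrite !mxE.
rewrite -expr2; have := @cauchy_schwarz_form b 1%:M (trmx1 _ _).
have B0 (w : 'cV[R]_b) : 0 <= dot w (1%:M *m w) by rewrite mul1mx; exact: dot_ge0.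
by move=> /(_ B0 (row i A)^T u); rewrite !mul1mx.
Qed.

Lemma norm2_mulmx_le_opnorm2 a b (A : 'M[R]_(a, b)) u :
  norm2 (A *m u) <= opnorm2 A * norm2 u.
Proof.
have [->|u0] := eqVneq u 0; first by rewrite mulmx0 !norm20 mulr0.
have nu0 : 0 < norm2 u by rewrite norm2_gt0.
rewrite -ler_pdivrMr//.
have -> : norm2 (A *m u) / norm2 u = norm2 (A *m ((norm2 u)^-1 *: u)).
  by rewrite -scalemxAr norm2Z ger0_norm ?invr_ge0 ?norm2_ge0// mulrC.
apply: ub_le_sup; last first.
  exists ((norm2 u)^-1 *: u) => //=.
  by rewrite norm2Z ger0_norm ?invr_ge0 ?norm2_ge0// mulVf// gt_eqF.
have [K K0 hK] := mulmx_bounded A; exists K => _ [v /= v1 <-].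
by rewrite (le_trans (hK v))// ler_piMr.
Qed.

(** A matrix and its transpose have the same operator norm, since the square
    of norm2 (A^T v) is the dot product of v and A (A^T v). *)
Lemma norm2_trmx_mulmx_le a b (A : 'M[R]_(a, b)) (K : R) : 0 <= K ->
  (forall u, norm2 (A *m u) <= K * norm2 u) ->
  forall v, norm2 (A^T *m v) <= K * norm2 v.
Proof.
move=> K0 hA v; have [->|Av0] := eqVneq (A^T *m v) 0.
  by rewrite norm20 mulr_ge0// norm2_ge0.
have nAv0 : 0 < norm2 (A^T *m v) by rewrite norm2_gt0.
rewrite -(ler_pM2r nAv0) -expr2 sqr_norm2 dot_mulmxl trmxK.
by rewrite (le_trans (cauchy_schwarz _ _))// mulrC mulrAC ler_wpM2r ?norm2_ge0.
Qed.

(** With v := B^-1 u, Cauchy-Schwarz for the form of B bounds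
    (dot u u) ^ 2 = (dot u (B v)) ^ 2 by dot u (B u) * dot v u, and the last
    factor is at most a multiple of dot u u. *)
Lemma sym_nonsingular_form_ge n (B : 'M[R]_n) : B^T = B ->
  (forall u, 0 <= dot u (B *m u)) -> B \in unitmx ->
  exists2 e, 0 < e & forall u, e * dot u u <= dot u (B *m u).
Proof.
move=> symB B0 uB; have [K K0 hK] := mulmx_bounded (invmx B).
exists (K + 1)^-1; first by rewrite invr_gt0 ltr_wpDl.
move=> u; have [->|u0] := eqVneq u 0.
  by rewrite !dot0l mulr0.
have uu : 0 < dot u u by rewrite lt_def dot_eq0 u0 dot_ge0.
pose v := invmx B *m u; have Bv : B *m v = u by rewrite mulmxA mulmxV// mul1mx.
have := cauchy_schwarz_form symB B0 u v; rewrite Bv => CS.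
have vu : dot v u <= (K + 1) * dot u u.
  rewrite (le_trans (cauchy_schwarz _ _))// -sqr_norm2 expr2 mulrA.
  rewrite ler_wpM2r ?norm2_ge0// (le_trans (hK u))//.
  by rewrite ler_wpM2r ?norm2_ge0// lerDl.
rewrite mulrC ler_pdivrMr ?ltr_wpDl// -(ler_pM2r uu) -expr2 (le_trans CS)//.
by rewrite -mulrA ler_wpM2l.
Qed.

(** The infimum l of the quadratic form of A A^T on the unit sphere is an
    eigenvalue: A A^T - l is positive semidefinite, and if it were invertible
    its form would be bounded away from 0 on the sphere. So the square root of
    l is a singular value, at least sigma_min A. This avoids both compactness
    of the sphere and the spectral theorem. *)
Lemma sigma_min_le_norm2 a b (A : 'M[R]_(a, b)) (s : R) : 0 < s ->
  s <= sigma_min A -> forall v, s * norm2 v <= norm2 (A^T *m v).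
Proof.
move=> s0 sA v; have [->|v0] := eqVneq v 0; first by rewrite norm20 mulr0 norm2_ge0.
pose q u := dot u ((A *m A^T) *m u).
have qE u : q u = norm2 (A^T *m u) ^+ 2.
  by rewrite sqr_norm2 [RHS]dot_mulmxl trmxK mulmxA.
have qZ t u : q (t *: u) = t ^+ 2 * q u.
  by rewrite /q -scalemxAr dotZl dotZr mulrA.
pose S := [set q u | u in [set u : 'cV[R]_a | dot u u = 1]].
have unit_vec u : u != 0 -> S (q u / dot u u).
  move=> u0; exists ((norm2 u)^-1 *: u) => /=; last first.
    by rewrite qZ exprVn sqr_norm2 mulrC.
  rewrite -sqr_norm2 norm2Z exprMn real_normK ?num_real// -exprMn.
  by rewrite mulVf ?expr1n ?norm2_eq0.
have S_lb : lbound S 0 by move=> _ [u _ <-]; rewrite qE sqr_ge0.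
have S_inf : has_inf S by split; [exists (q v / dot v v); exact: unit_vec|exists 0].
pose l := inf S; pose B := A *m A^T - l%:M.
have l0 : 0 <= l by apply: lb_le_inf => //; case: S_inf.
have BE u : dot u (B *m u) = q u - l * dot u u.
  by rewrite /B mulmxBl dotBr mul_scalar_mx dotZr.
have symB : B^T = B by rewrite /B linearB/= trmx_mul trmxK tr_scalar_mx.
have lq u : l * dot u u <= q u.
  have [->|u0] := eqVneq u 0; first by rewrite /q !dot0l mulr0.
  rewrite -ler_pdivlMr ?lt_def ?dot_eq0 ?u0 ?dot_ge0//.
  by apply: ge_inf; [case: S_inf|exact: unit_vec].
have B0 u : 0 <= dot u (B *m u) by rewrite BE subr_ge0.
(* a nonsingular B would leave room below the infimum l *)
have singB : B \notin unitmx.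
  apply/negP => uB; have [e e0 he] := sym_nonsingular_form_ge symB B0 uB.
  have : l + e <= l; last by rewrite gerDl leNgt e0.
  apply: lb_le_inf; first by case: S_inf.
  by move=> _ [u u1 <-]; have := he u; rewrite BE u1; lra.
have sl : singular_value A (Num.sqrt l).
  split; first exact: sqrtr_ge0.
  rewrite sqr_sqrtr// /eigenvalue /eigenspace kermx_eq0 row_free_unit.
  by rewrite (_ : _ - _ = B).
have s_le : s <= Num.sqrt l.
  apply: le_trans sA _; apply: ge_inf => //.
  by exists 0 => x [].
rewrite -(ler_pXn2r (n := 2)) ?nnegrE ?mulr_ge0 ?norm2_ge0 ?(ltW s0)//.
rewrite exprMn -qE sqr_norm2 (le_trans _ (lq v))// ler_wpM2r ?dot_ge0//.
by rewrite -[leRHS](sqr_sqrtr l0) ler_pXn2r ?nnegrE ?sqrtr_ge0 ?(ltW s0).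
Qed.
End EuclideanTheory.

(** * Functions with Lipschitz gradient *)

Section DescentLemma.
Set Implicit Arguments.
Unset Strict Implicit.
Context {R : realType}.

Lemma derive_gradient n (f : 'cV[R]_n -> R) (x v : 'cV[R]_n) :
  differentiable f x -> 'D_v f x = dot (gradient f x) v.
Proof.
move=> df; rewrite deriveE//.
have {1}-> : v = \sum_i v i 0 *: delta_mx i 0.
  by rewrite [LHS]matrix_sum_delta; apply: eq_bigr => i _; rewrite big_ord1.
rewrite linear_sum; apply: eq_bigr => i _.
by rewrite linearZ /= mxE deriveE// mulrC.
Qed.

Lemma is_derive_line n (f : 'cV[R]_n -> R) (x v : 'cV[R]_n) (t : R) :
  differentiable f (x + t *: v) ->
  is_derive t 1 (fun u => f (x + u *: v)) (dot (gradient f (x + t *: v)) v).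
Proof.
move=> df; rewrite -derive_gradient//.
have E : (fun h : R => h^-1 *: (((fun u => f (x + u *: v)) \o shift t) (h *: (1 : R)) -
    f (x + t *: v))) =
  (fun h => h^-1 *: ((f \o shift (x + t *: v)) (h *: v) - f (x + t *: v))).
  apply/funext => h; congr (_ *: (f _ - _)).
  by rewrite /= [h *: 1]mulr1 scalerDl addrCA.
split; last by rewrite /derive E.
by rewrite /derivable E; exact: diff_derivable.
Qed.

(** Along the segment, the difference of the two sides has derivative
    dot (gradient f (x + t v) - gradient f x) v - L t |v| ^ 2, which is
    nonpositive by Cauchy-Schwarz and the Lipschitz condition. *)
Lemma lipschitz_gradient_upper_bound n (f : 'cV[R]_n -> R) (L : R) : 0 <= L ->
  (forall x, differentiable f x) ->
  (forall x y, norm2 (gradient f x - gradient f y) <= L * norm2 (x - y)) ->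
  forall x v, f (x + v) <= f x + dot (gradient f x) v + L / 2 * norm2 v ^+ 2.
Proof.
move=> L0 df lip x v.
pose h t := f (x + t *: v) - (t * dot (gradient f x) v + L / 2 * norm2 v ^+ 2 * t ^+ 2).
pose dh t := dot (gradient f (x + t *: v)) v -
  (dot (gradient f x) v + L * norm2 v ^+ 2 * t).
have hd (t : R) : is_derive t 1 h (dh t).
  apply: is_deriveB; first exact: is_derive_line.
  apply: is_derive_eq.
  by rewrite scaler0 add0r ![_%:A]mulr1 /GRing.scale/=; field.
have hc : {within `[(0:R), 1], continuous h}.
  apply: continuous_subspaceT => u; apply: differentiable_continuous.
  by apply/derivable1_diffP; case: (hd u).
have [t] := MVT_segment ler01 (fun t _ => hd t) hc.
rewrite in_itv/= => /andP[t0 _]; rewrite subr0 mulr1 => hE.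
have dh0 : dh t <= 0.
  rewrite /dh opprD addrA -dotBl subr_le0 (le_trans (cauchy_schwarz _ _))//.
  rewrite expr2 mulrA mulrAC ler_wpM2r ?norm2_ge0// (le_trans (lip _ _))//.
  by rewrite addrAC subrr add0r norm2Z ger0_norm// mulrA mulrAC.
move: dh0; rewrite -hE /h !scale1r !scale0r addr0.
lra.
Qed.

End DescentLemma.

(** * A good iteration with a small step succeeds *)

Section OneIteration.
Set Implicit Arguments.
Unset Strict Implicit.
Context {R : realType}.
Variables (n r m : nat) (f : 'cV[R]_n -> R).

(** What the bounds on the operator norm and on the smallest singular value
    are used for. Unlike these bounds, it is visibly a closed condition on P,
    hence measurable. *)
Definition conditioned (sigma Pmax : R) (P : 'M[R]_(r, n)) : Prop :=
  (forall u, norm2 (P *m u) <= Pmax * norm2 u) /\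
  (forall v, sigma * norm2 v <= norm2 (P^T *m v)).

Definition aligned_conditioned (eta sigma Pmax : R) (x : 'cV[R]_n)
    (P : 'M[R]_(r, n)) : Prop :=
  eta * norm2 (gradient f x) <= norm2 (P *m gradient f x) /\
  conditioned sigma Pmax P.

(** The cosine condition cleared of its denominators: it is an inequality
    between measurable functions, and it holds trivially when P kills the
    gradient. *)
Definition has_descent_direction (kappa Dmax : R) (x : 'cV[R]_n)
    (P : 'M[R]_(r, n)) (D : 'I_m -> 'cV[R]_r) : Prop :=
  (exists i, kappa * (norm2 (D i) * norm2 (P *m gradient f x)) <=
     - dot (D i) (P *m gradient f x)) /\
  forall i, Dmax^-1 <= norm2 (D i) <= Dmax.

Lemma well_aligned_conditioned (eta sigma Pmax : R) x P : 0 < sigma ->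
  well_aligned f eta sigma Pmax x P -> aligned_conditioned eta sigma Pmax x P.
Proof.
move=> s0 [Pg PP sP]; split=> //; split=> [u|v].
  by rewrite (le_trans (norm2_mulmx_le_opnorm2 _ _))// ler_wpM2r ?norm2_ge0.
exact: sigma_min_le_norm2.
Qed.

Lemma bigmax_ge_ex (I : finType) (F : I -> R) (y z : R) : z < y ->
  y <= \big[Num.max/z]_i F i -> exists i, y <= F i.
Proof.
move=> zy yF; apply: contrapT => /forallNP nF; move: yF; apply/negP.
rewrite -ltNge; apply/bigmax_ltP; split=> // i _.
by rewrite ltNge; apply/negP.
Qed.

Lemma descent_set_direction (kappa Dmax : R) x (P : 'M[R]_(r, n))
    (D : 'I_m -> 'cV[R]_r) : 0 < kappa -> 1 < Dmax ->
  descent_set f kappa Dmax x P D -> has_descent_direction kappa Dmax x P D.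
Proof.
move=> k0 Dmax1 [kD normD]; split=> //.
have [i] := bigmax_ge_ex (lt_trans (ltrN10 R) k0) kD.
rewrite /descent_cos; case: eqVneq => [-> _|Pg0 kD']; exists i.
  by rewrite norm20 dotC dot0l mulr0 mulr0 oppr0.
have nd : 0 < norm2 (D i).
  by case/andP: (normD i) => + _; apply: lt_le_trans; rewrite invr_gt0; lra.
by rewrite -ler_pdivlMr ?mulr_gt0 ?(norm2_gt0 (P *m _)).
Qed.

(** If the step failed, the angle condition and the quadratic upper bound on f
    would give kappa * eta * |g| <= (L + c) / 2 * a * Pmax ^ 2 * |d|, against
    the bound on a. *)
Lemma small_step_sufficient_decrease
    (L c eta sigma Pmax kappa Dmax eps a : R) x P (D : 'I_m -> 'cV[R]_r) :
  0 < L -> (forall x, differentiable f x) ->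
  (forall x y, norm2 (gradient f x - gradient f y) <= L * norm2 (x - y)) ->
  0 < c -> 0 < eta -> 0 < Pmax -> 0 < kappa -> 1 < Dmax ->
  aligned_conditioned eta sigma Pmax x P ->
  has_descent_direction kappa Dmax x P D ->
  0 < a -> 0 < eps -> eps < norm2 (gradient f x) ->
  a <= 2 * kappa * eta / ((L + c) * Pmax ^+ 2 * Dmax ^+ 3) * eps ->
  exists i, sufficient_decrease f c a x (P^T *m D i).
Proof.
move=> L0 df lip c0 eta0 Pmax0 k0 Dmax1 [Pg [PP _]] [[i di] normD] a0 e0 eg aeps.
exists i; rewrite /sufficient_decrease ltNge; apply/negP => fail.
set g := gradient f x in Pg di eg; set dd := D i in di fail.
have /andP[+ ddD] := normD i; rewrite -/dd in ddD * => Ddd.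
have D0 : 0 < Dmax by lra.
have nd : 0 < norm2 dd by apply: lt_le_trans Ddd; rewrite invr_gt0.
have := lipschitz_gradient_upper_bound (ltW L0) df lip x (a *: (P^T *m dd)).
rewrite -/g dotZr [dot g _]dotC dot_mulmxl trmxK norm2Z gtr0_norm// exprMn => up.
set y := norm2 (P^T *m dd) in fail up.
have yP : y ^+ 2 <= Pmax ^+ 2 * norm2 dd ^+ 2.
  rewrite -exprMn lerXn2r ?nnegrE ?mulr_ge0 ?(ltW Pmax0) ?norm2_ge0//.
  exact: norm2_trmx_mulmx_le (ltW Pmax0) PP _.
have g0 : 0 < norm2 g by exact: lt_trans eg.
(* first-order decrease from the angle condition against the second-order terms
   of the upper bound on f and of the failed decrease test *)
have h1 : a * (kappa * (norm2 dd * (eta * norm2 g))) <=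
    (L + c) / 2 * a ^+ 2 * (Pmax ^+ 2 * norm2 dd ^+ 2).
  have h2 : a * (kappa * (norm2 dd * (eta * norm2 g))) <=
      a * - dot dd (P *m g).
    rewrite ler_wpM2l ?(ltW a0)// (le_trans _ di)//.
    by rewrite ler_wpM2l ?(ltW k0)// ler_wpM2l ?(ltW nd).
  have h3 : (L + c) / 2 * a ^+ 2 * y ^+ 2 <=
      (L + c) / 2 * a ^+ 2 * (Pmax ^+ 2 * norm2 dd ^+ 2).
    by rewrite ler_wpM2l// mulr_ge0 ?sqr_ge0// divr_ge0// addr_ge0 ?ltW.
  move: h2 h3 up fail; lra.
have {h1} : kappa * eta * norm2 g <= (L + c) / 2 * a * Pmax ^+ 2 * norm2 dd.
  rewrite -(ler_pM2l (mulr_gt0 a0 nd)); move: h1; congr (_ <= _); ring.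
apply/negP; rewrite -ltNge.
apply: (@le_lt_trans _ _ (kappa * eta * eps)); last first.
  by rewrite ltr_pM2l// mulr_gt0.
apply: (@le_trans _ _ ((L + c) / 2 *
    (2 * kappa * eta / ((L + c) * Pmax ^+ 2 * Dmax ^+ 3) * eps) *
    Pmax ^+ 2 * Dmax)).
  rewrite ler_pM// ?norm2_ge0//.
    by rewrite !mulr_ge0 ?sqr_ge0 ?invr_ge0 ?addr_ge0 ?ltW.
  rewrite ler_wpM2r ?sqr_ge0// ler_wpM2l// divr_ge0// addr_ge0 ?ltW//.
have -> : (L + c) / 2 *
    (2 * kappa * eta / ((L + c) * Pmax ^+ 2 * Dmax ^+ 3) * eps) *
    Pmax ^+ 2 * Dmax = kappa * eta * eps * (Dmax ^- 2).
  by field; rewrite ?gt_eqF// addr_gt0.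
rewrite ler_piMr ?mulr_ge0 ?(ltW k0) ?(ltW eta0) ?(ltW e0)//.
by rewrite invf_le1 ?exprn_gt0// exprn_ege1// ltW.
Qed.

End OneIteration.

(** * Counting good iterations along a trajectory *)

Section LogBase.
Set Implicit Arguments.
Unset Strict Implicit.
Context {R : realType}.
Variable b : R.
Hypothesis b1 : 1 < b.

Let lnb : 0 < ln b. Proof. exact: ln_gt0. Qed.

Lemma log_baseM (u v : R) : 0 < u -> 0 < v ->
  log_base b (u * v) = log_base b u + log_base b v.
Proof. by move=> u0 v0; rewrite /log_base lnM ?posrE// mulrDl. Qed.

Lemma log_baseV (u : R) : 0 < u -> log_base b u^-1 = - log_base b u.
Proof. by move=> u0; rewrite /log_base lnV ?posrE// mulNr. Qed.

Lemma log_base_self : log_base b b = 1.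
Proof. by rewrite /log_base divff// gt_eqF. Qed.

Lemma ler_log_base (u v : R) : 0 < u -> 0 < v ->
  (log_base b u <= log_base b v) = (u <= v).
Proof. by move=> u0 v0; rewrite /log_base ler_pM2r ?invr_gt0// ler_ln ?posrE. Qed.
End LogBase.

Section Potential.
Set Implicit Arguments.
Unset Strict Implicit.
Context {R : realType}.

(** Here tau is the logarithm of the step size, nu that of the threshold below
    which good iterations succeed, and w is f in units of the decrease guaranteed
    by a good success with a large step. The clamp level nu - mu is chosen so
    that a good failure, which starts above nu, ends above the clamp level: it
    lowers the maximum by exactly mu and leaves the minimum alone. *)
Definition potential (mu nu w tau : R) : R :=
  (1 + mu^-1) * w + Num.max tau (nu - mu) / mu - Num.min tau (nu - mu).

(** A bad iteration costs at most M, since a success raises the maximum by at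
    most 1 and a failure lowers the minimum by at most mu. A good iteration
    must gain 1: a failure gains it in the maximum; a success gains it in the minimum
    when tau <= nu - mu - 1, and otherwise in w, whose weight 1 + 1 / mu also
    makes up for the possible rise of the maximum. *)
Lemma potential_step (good succ : bool) (mu nu M w w' tau tau' : R) :
  0 < mu -> mu <= M -> mu^-1 <= M -> w' <= w ->
  (succ -> tau <= tau' <= tau + 1) -> (~~ succ -> tau' = tau - mu) ->
  (succ -> tau <= nu - mu - 1 -> tau' = tau + 1) ->
  (good -> ~~ succ -> nu < tau) ->
  (good -> succ -> nu - mu - 1 < tau -> 1 <= w - w') ->
  good%:R * (1 + M) <= M + (potential mu nu w tau - potential mu nu w' tau').
Proof.
move=> mu0 muM iM ww' tau_succ tau_fail up gf gs.
pose i := mu^-1; have i0 : 0 < i by rewrite invr_gt0.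
have imu : i * mu = 1 by rewrite mulVf// gt_eqF.
suff H : good%:R * (1 + M) <= M + (1 + i) * (w - w') +
    i * (Num.max tau (nu - mu) - Num.max tau' (nu - mu)) -
    (Num.min tau (nu - mu) - Num.min tau' (nu - mu)).
  by apply: le_trans H _; rewrite /potential -/i; lra.
have dw : 0 <= (1 + i) * (w - w') by rewrite mulr_ge0 ?subr_ge0// addr_ge0 ?(ltW i0).
rewrite -/i in iM.
case: succ tau_succ tau_fail up gf gs => /=.
  move=> /(_ isT)/andP[tau_le tau_le1] _ /(_ isT) up _ gs.
  have max_up : - i <=
      i * (Num.max tau (nu - mu) - Num.max tau' (nu - mu)).
    rewrite -[leLHS]mulr1 mulNr -mulrN ler_wpM2l ?(ltW i0)//.
    by case: (leP tau (nu - mu)); case: (leP tau' (nu - mu)); lra.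
  have min_up : Num.min tau (nu - mu) <= Num.min tau' (nu - mu).
    by case: (leP tau (nu - mu)); case: (leP tau' (nu - mu)); lra.
  case: good gs => /=; last by move=> _; rewrite mul0r; lra.
  move=> /(_ isT isT) gs; have [low|/gs high] := leP tau (nu - mu - 1).
    have tau'E := up low.
    rewrite !max_r ?min_l; [lra..].
  have : (1 + i) * 1 <= (1 + i) * (w - w').
    by rewrite ler_wpM2l// addr_ge0 ?(ltW i0).
  lra.
move=> _ /(_ isT) -> _ gf _; case: good gf => /=.
  move=> /(_ isT isT) tau_gt; rewrite !max_l ?min_r; lra.
move=> _; rewrite mul0r.
have : 0 <= i * (Num.max tau (nu - mu) - Num.max (tau - mu) (nu - mu)).
  rewrite mulr_ge0 ?(ltW i0)//.
  by case: (leP tau (nu - mu)); case: (leP (tau - mu) (nu - mu)); lra.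
have : Num.min tau (nu - mu) - Num.min (tau - mu) (nu - mu) <= mu.
  by case: (leP tau (nu - mu)); case: (leP (tau - mu) (nu - mu)); lra.
lra.
Qed.

Lemma telescope_le (z V : nat -> R) (a : R) k :
  (forall j, (j < k)%N -> z j <= a + (V j - V j.+1)) ->
  \sum_(0 <= j < k) z j <= a * k%:R + (V 0%N - V k).
Proof.
elim: k => [|k IH] h; first by rewrite big_geq// mulr0 subrr addr0.
rewrite big_nat_recr//= -natr1 mulrDr mulr1.
have := IH (fun j jk => h j (ltnW jk)); have := h k (ltnSn k); lra.
Qed.
End Potential.

Section Trajectory.
Set Implicit Arguments.
Unset Strict Implicit.
Context {R : realType}.
Variables (n r m : nat) (f : 'cV[R]_n -> R) (L flow : R).
Hypotheses (hL : 0 < L) (f_diff : forall x, differentiable f x).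
Hypothesis f_lip : forall x y,
  norm2 (gradient f x - gradient f y) <= L * norm2 (x - y).
Hypothesis f_low : forall x, flow <= f x.
Variables (x0 : 'cV[R]_n) (amax a0 c gdec ginc : R).
Hypotheses (ha0 : 0 < a0 <= amax) (hc : 0 < c) (hdec : 0 < gdec < 1).
Hypothesis hinc : 1 < ginc.
Variables (P : nat -> 'M[R]_(r, n)) (D : nat -> 'I_m -> 'cV[R]_r).
Variables (x : nat -> 'cV[R]_n) (alpha : nat -> R).
Hypothesis run : direct_search f x0 amax a0 c gdec ginc P D x alpha.

Lemma direct_search_step_size k : 0 < alpha k <= amax.
Proof.
have [_ alpha0 step] := run; have /andP[gdec0 gdec1] := hdec.
elim: k => [|k /andP[a_gt0 a_le]]; first by rewrite alpha0.
case: (step k) => [[i [_ _ ->]]|[_ _ ->]].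
  rewrite lt_min mulr_gt0 ?(lt_trans ltr01 hinc)//=.
  by rewrite (lt_le_trans a_gt0 a_le)/= ge_min lexx orbT.
by rewrite mulr_gt0//= (le_trans _ a_le)// ler_piMl ?ltW.
Qed.

Variables (eta sigma Pmax kappa Dmax eps : R).
Hypotheses (heta : 0 < eta) (hsigma : 0 < sigma) (hPmax : 0 < Pmax).
Hypotheses (hkappa : 0 < kappa) (hDmax : 1 < Dmax) (heps : 0 < eps).

Let abar := 2 * kappa * eta / ((L + c) * Pmax ^+ 2 * Dmax ^+ 3).
Let mu := log_base ginc gdec^-1.

Hypothesis a0_large : abar * eps <= ginc^-1 * a0.

(** Telescoping [potential_step]. Initially tau is at least nu + 1, so the
    minimum starts at its largest value and contributes nothing; the maximum
    contributes (tau - nu + mu) / mu and w the total decrease of f. *)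
Lemma good_iterations_le (good : nat -> bool) (M : R) k :
  (forall j, good j -> aligned_conditioned f eta sigma Pmax (x j) (P j) /\
     has_descent_direction f kappa Dmax (x j) (P j) (D j)) ->
  mu <= M -> mu^-1 <= M ->
  (forall j, (j < k)%N -> eps < norm2 (gradient f (x j))) ->
  (\sum_(0 <= j < k) (good j)%:R) * (1 + M) <= M * k%:R +
    (1 + mu^-1) * (2 * Dmax ^+ 2 * ginc ^+ 2 /
       (c * sigma ^+ 2 * gdec ^+ 2 * (abar * eps) ^+ 2) * (f x0 - flow)) +
    log_base ginc (a0 / (abar * eps)) / mu + 1.
Proof.
move=> good_ok muM iM g_large.
have /andP[gdec0 gdec1] := hdec; have /andP[a0_gt0 a0_le] := ha0.
have ginc0 : 0 < ginc by exact: lt_trans ltr01 hinc.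
have D0 : 0 < Dmax by exact: lt_trans ltr01 hDmax.
have abar0 : 0 < abar.
  by rewrite divr_gt0 ?mulr_gt0 ?exprn_gt0 ?addr_gt0.
have a0_e := a0_large; set e := abar * eps in a0_e *; have e0 : 0 < e by exact: mulr_gt0.
have eE : e = abar * eps by []; clearbody e.
have mu0 : 0 < mu.
  by rewrite divr_gt0 ?ln_gt0// invf_gt1.
pose nu := log_base ginc e.
(* step sizes up to theta remain at most e * gdec after a success, so that the
   clamped minimum of the potential rises by a full unit *)
pose theta := e * gdec / ginc.
have theta0 : 0 < theta := divr_gt0 (mulr_gt0 e0 gdec0) ginc0.
have thetaE : log_base ginc theta = nu - mu - 1.
  have eg0 := mulr_gt0 e0 gdec0; have ginc_inv0 : 0 < ginc^-1 by rewrite invr_gt0.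
  rewrite /theta (log_baseM _ eg0 ginc_inv0) (log_baseM _ e0 gdec0) log_baseV//.
  by rewrite log_base_self// /mu log_baseV// opprK.
pose tau j := log_base ginc (alpha j).
(* in a good success with a step size above theta, f decreases by at least
   1 / K *)
pose K := 2 * Dmax ^+ 2 * ginc ^+ 2 / (c * sigma ^+ 2 * gdec ^+ 2 * e ^+ 2).
have K0 : 0 < K by rewrite divr_gt0 ?mulr_gt0 ?exprn_gt0.
pose V j := potential mu nu (K * f (x j)) (tau j).
have [xE alphaE step] := run.
have decrease j (hjk : (j < k)%N) :
    (good j)%:R * (1 + M) <= M + (V j - V j.+1).
  have /andP[aj0 aj_le] := direct_search_step_size j.
  have step_j := step j.
  have fail_large : good j ->
      (forall i, ~ sufficient_decrease f c (alpha j) (x j) ((P j)^T *m D j i)) ->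
      nu < tau j.
    move=> /good_ok[PA DD] fail; rewrite ltNge /nu /tau ler_log_base//.
    apply/negP; rewrite eE => small.
    have [i] := small_step_sufficient_decrease hL f_diff f_lip hc heta
      hPmax hkappa hDmax PA DD aj0 heps (g_large j hjk) small.
    exact: fail.
  case: step_j => [[i [dec xj1 aj1]]|[fail xj1 aj1]].
    have fdec : c / 2 * alpha j ^+ 2 * norm2 ((P j)^T *m D j i) ^+ 2 <=
        f (x j) - f (x j.+1).
      by rewrite xj1; move: dec; rewrite /sufficient_decrease; lra.
    have tau_ginc : log_base ginc (ginc * alpha j) = tau j + 1.
      by rewrite log_baseM// log_base_self// addrC.
    have aj1_gt0 : 0 < alpha j.+1.
      by have /andP[] := direct_search_step_size j.+1.
    apply: (@potential_step _ _ true) => //.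
    - rewrite ler_wpM2l ?(ltW K0)// -subr_ge0 (le_trans _ fdec)//.
      by rewrite !mulr_ge0 ?norm2_ge0 ?invr_ge0 ?(ltW hc) ?(ltW aj0).
    - move=> _; rewrite -tau_ginc /tau !ler_log_base ?mulr_gt0//.
      rewrite aj1 le_min aj_le ge_min lexx /= andbT.
      by rewrite ler_peMl ?ltW.
    - move=> _; rewrite -thetaE ler_log_base// => small.
      rewrite -tau_ginc /tau aj1 min_l//.
      (* the cap on the step size is inactive below the initial step size *)
      rewrite (le_trans _ a0_le)// (@le_trans _ _ e)//.
        rewrite mulrC -ler_pdivlMr// (le_trans small)// /theta.
        by rewrite ler_pM2r ?invr_gt0// ler_piMr ?ltW.
      by rewrite (le_trans a0_e)// ler_piMl ?(ltW a0_gt0)// invf_le1 ?ltW.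
    - move=> /good_ok[[_ [_ Plow]] [_ normD]] _; rewrite -thetaE ltNge ler_log_base//.
      rewrite -ltNge -mulrBr => large.
      have lowP : sigma / Dmax <= norm2 ((P j)^T *m D j i).
        rewrite (le_trans _ (Plow _))// ler_wpM2l ?(ltW hsigma)//.
        by case/andP: (normD i).
      rewrite -(@mulVf _ (K^-1)) ?invr_eq0 ?gt_eqF// invrK ler_wpM2l ?(ltW K0)//.
      rewrite (le_trans _ fdec)//.
      rewrite (@le_trans _ _ (c / 2 * theta ^+ 2 * (sigma / Dmax) ^+ 2))//.
        rewrite le_eqVlt; apply/orP; left; apply/eqP.
        by rewrite /K /theta; field; rewrite !gt_eqF.
      have c2 : 0 <= c / 2 by rewrite divr_ge0 ?(ltW hc).
      rewrite ler_pM ?(mulr_ge0 c2 (sqr_ge0 _)) ?sqr_ge0//.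
        by rewrite (ler_wpM2l c2)// lerXn2r ?nnegrE ?(ltW theta0) ?(ltW aj0) ?(ltW large).
      by rewrite lerXn2r ?nnegrE ?norm2_ge0 ?divr_ge0 ?(ltW hsigma) ?(ltW D0).
  apply: (@potential_step _ _ false) => //; first by rewrite xj1.
  - move=> _; rewrite /tau aj1 log_baseM// addrC; congr (_ + _).
    by rewrite /mu log_baseV// opprK.
  - by move=> gj _; exact: fail_large.
have := telescope_le decrease; rewrite -mulr_suml => /le_trans; apply.
rewrite -!addrA lerD2l -/K.
have tau0 : nu <= tau 0%N - 1.
  rewrite lerBrDr -(log_base_self hinc) -log_baseM// ler_log_base ?mulr_gt0//.
    by rewrite alphaE mulrC -ler_pdivlMl.
  by rewrite alphaE.
have fk : K * (f x0 - f (x k)) <= K * (f x0 - flow).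
  by rewrite ler_wpM2l ?(ltW K0)// lerD2l lerN2.
have i0 : 0 < mu^-1 by rewrite invr_gt0.
have w_le : (1 + mu^-1) * (K * (f x0 - f (x k))) <= (1 + mu^-1) * (K * (f x0 - flow)).
  by rewrite ler_wpM2l ?addr_ge0 ?(ltW i0).
have max_k : (nu - mu) * mu^-1 <= Num.max (tau k) (nu - mu) * mu^-1.
  by rewrite ler_wpM2r ?(ltW i0)// le_max lexx orbT.
have min_k : Num.min (tau k) (nu - mu) <= nu - mu by rewrite ge_min lexx orbT.
rewrite log_baseM ?invr_gt0// log_baseV// -/nu -[a0]alphaE -/(tau 0%N).
have muV : mu * mu^-1 = 1 by rewrite divff// gt_eqF.
have clamp0 : nu - mu <= tau 0%N by lra.
rewrite /V /potential xE max_l// min_r//; lra.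
Qed.

End Trajectory.

Section Constants.
Set Implicit Arguments.
Unset Strict Implicit.
Context {R : realType}.

(** The left-hand side is what [good_iterations_le] allows. The right-hand
    side is at least as large because gdec < 1 < ginc and because its logarithm
    is log_base ginc (a0 / e) / mu + 1 / mu + 2. *)
Lemma iteration_budget (mu gdec ginc beta e a0 : R) :
  0 < gdec < 1 -> 1 < ginc -> 0 <= beta -> 0 < e -> 0 < a0 ->
  mu = log_base ginc gdec^-1 ->
  (1 + mu^-1) * (ginc ^+ 2 / (gdec ^+ 2 * e ^+ 2) * beta) +
    log_base ginc (a0 / e) / mu + 1 <=
  (mu * gdec ^+ 2 + ginc ^+ 2) * ginc ^+ 2 * beta / (mu * gdec ^+ 4) / e ^+ 2 +
    log_base gdec (gdec ^+ 2 * e / (ginc * a0)).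
Proof.
move=> /andP[gdec0 gdec1] ginc1 beta0 e0 a00 muE.
have ginc0 : 0 < ginc by exact: lt_trans ltr01 ginc1.
have lnd : ln gdec < 0 by rewrite ln_lt0// gdec0.
have lni : 0 < ln ginc by exact: ln_gt0.
have mu_ln : mu = - ln gdec / ln ginc by rewrite muE /log_base lnV ?posrE.
have mu0 : 0 < mu by rewrite mu_ln divr_gt0// oppr_gt0.
have i0 : 0 < mu^-1 by rewrite invr_gt0.
have logE : log_base gdec (gdec ^+ 2 * e / (ginc * a0)) =
    log_base ginc (a0 / e) / mu + mu^-1 + 2.
  rewrite /log_base !(lnM, lnV, lnXn) ?posrE ?(mulr_gt0, invr_gt0, exprn_gt0)//.
  rewrite mu_ln; field.
  by rewrite (gt_eqF lni) (lt_eqF lnd).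
rewrite logE.
have main : (1 + mu^-1) * (ginc ^+ 2 / (gdec ^+ 2 * e ^+ 2) * beta) <=
  (mu * gdec ^+ 2 + ginc ^+ 2) * ginc ^+ 2 * beta / (mu * gdec ^+ 4) / e ^+ 2.
  rewrite -subr_ge0.
  have -> : (mu * gdec ^+ 2 + ginc ^+ 2) * ginc ^+ 2 * beta / (mu * gdec ^+ 4) / e ^+ 2
     - (1 + mu^-1) * (ginc ^+ 2 / (gdec ^+ 2 * e ^+ 2) * beta) =
     ginc ^+ 2 * beta / (mu * gdec ^+ 4 * e ^+ 2) * (ginc ^+ 2 - gdec ^+ 2).
    by field; rewrite !gt_eqF.
  rewrite mulr_ge0 ?divr_ge0 ?mulr_ge0 ?exprn_ge0 ?(ltW ginc0) ?(ltW mu0)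
    ?(ltW gdec0) ?(ltW e0)//.
  rewrite subr_ge0 lerXn2r ?nnegrE ?(ltW ginc0) ?(ltW gdec0)//.
  by rewrite (le_trans (ltW gdec1))// ltW.
move: main i0; lra.
Qed.
End Constants.

(** * Measurability of functions of random matrices *)

Section RandomMatrices.
Set Implicit Arguments.
Unset Strict Implicit.
Context {R : realType} {d : measure_display} {T : measurableType d}.

Definition entrywise_measurable a b (X : T -> 'M[R]_(a, b)) : Prop :=
  forall i j, measurable_fun setT (fun w => X w i j).

(** An open set of matrices is a countable union of boxes with rational
    centers, and the preimage of a box is a finite intersection of events
    about single entries. *)
Lemma measurable_preimage_open a b (X : T -> 'M[R]_(a, b)) (U : set 'M[R]_(a, b)) :
  entrywise_measurable X -> open U -> measurable (X @^-1` U).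
Proof.
move=> mX oU.
pose box (qN : 'M[rat]_(a, b) * nat) : set 'M[R]_(a, b) :=
  ball (map_mx ratr qN.1 : 'M[R]_(a, b)) (qN.2.+1%:R^-1 : R).
have mbox qN : measurable (X @^-1` box qN).
  have N0 : (0 : R) < qN.2.+1%:R^-1 by rewrite invr_gt0.
  rewrite [X in measurable X](_ : _ = \bigcap_(ij in [set: 'I_a * 'I_b])
      ((fun w => X w ij.1 ij.2) @^-1` ball (ratr (qN.1 ij.1 ij.2) : R) (qN.2.+1%:R^-1))).
    apply: fin_bigcap_measurable => //= -[i j] _; rewrite -[X in measurable X]setTI.
    by apply: mX => //; apply: open_measurable; exact: ball_open.
  apply/seteqP; split=> w /=.
    by move=> [_ h] [i j] _ /=; have := h i j; rewrite mxE.
  by move=> h; split=> // i j; rewrite mxE; exact: (h (i, j)).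
rewrite [X in measurable X](_ : _ =
    \bigcup_qN (if `[< box qN `<=` U >] then X @^-1` box qN else set0)).
  apply: countable_bigcupT_measurable => // qN.
  by case: asboolP => // _; exact: measurable0.
apply/seteqP; split=> w /=; last first.
  by move=> [qN _]; case: asboolP => // boxU /boxU.
move=> UXw; have : nbhs (X w) U by exact: open_nbhs_nbhs.
move=> /nbhs_ballP[e /= e0 ballU].
have [N] : exists N, 0 + N.+1%:R^-1 < e / 2.
  by apply: ltr_add_invr; rewrite divr_gt0.
rewrite add0r => Ne; have N0 : (0 : R) < N.+1%:R^-1 by rewrite invr_gt0.
have approx i j : exists q : rat, ball (ratr q : R) (N.+1%:R^-1) (X w i j).
  have [|q] := @rat_in_itvoo R (X w i j - N.+1%:R^-1) (X w i j).
    by rewrite ltrBlDr ltrDl.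
  rewrite in_itv/= => /andP[q1 q2]; exists q.
  rewrite /ball/= ltr_norml ltrBrDr addrC q1/=.
  by rewrite ltrBlDr (lt_trans q2)// ltrDr.
pose q : 'M[rat]_(a, b) := \matrix_(i, j) sval (cid (approx i j)).
have qXw : ball (map_mx ratr q : 'M[R]_(a, b)) (N.+1%:R^-1) (X w).
  by split=> // i j; rewrite !mxE; case: cid.
exists (q, N) => //; case: asboolP => [//|[]] Y /= qY.
apply: ballU; apply: (@le_ball _ _ _ (N.+1%:R^-1 + N.+1%:R^-1)).
  by rewrite [leRHS]splitr lerD ?ltW.
exact: ball_triangle (ball_sym qXw) qY.
Qed.

Lemma continuous_entrywise_measurable a b a' b' (X : T -> 'M[R]_(a, b))
    (h : 'M[R]_(a, b) -> 'M[R]_(a', b')) :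
  entrywise_measurable X -> continuous h -> entrywise_measurable (h \o X).
Proof.
move=> mX ch i j; apply: (measurability _ (RGenOInfty.measurableE R)).
move=> _ [_ [y ->] <-]; rewrite setTI.
apply: (measurable_preimage_open (U := [set Y | h Y i j \in `]y, +oo[])) mX _.
apply: (@open_comp _ _ (fun Y => h Y i j) `]y, +oo[%classic).
  move=> Y _; apply: (@continuous_comp _ _ _ h (fun Z => Z i j)); first exact: ch.
  exact: coord_continuous.
exact: interval_open.
Qed.

Lemma measurable_dot n (X Y : T -> 'cV[R]_n) : entrywise_measurable X ->
  entrywise_measurable Y -> measurable_fun setT (fun w => dot (X w) (Y w)).
Proof.
by move=> mX mY; apply: measurable_sum => i; exact: measurable_funM.
Qed.

Lemma measurable_norm2 n (X : T -> 'cV[R]_n) : entrywise_measurable X ->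
  measurable_fun setT (fun w => norm2 (X w)).
Proof.
move=> mX.
have m_dot := measurable_dot mX mX.
by have := measurableT_comp (continuous_measurable_fun (@sqrt_continuous R)) m_dot.
Qed.

Lemma entrywise_measurable_mulmx a b c (X : T -> 'M[R]_(a, b))
    (Y : T -> 'M[R]_(b, c)) : entrywise_measurable X ->
  entrywise_measurable Y -> entrywise_measurable (fun w => X w *m Y w).
Proof.
move=> mX mY i j; under eq_fun do rewrite mxE.
by apply: measurable_sum => k; exact: measurable_funM.
Qed.

Lemma measurable_ler_set (g h : T -> R) : measurable_fun setT g ->
  measurable_fun setT h -> measurable [set w | g w <= h w].
Proof.
by move=> mg mh; rewrite -[X in measurable X]setTI; exact: measurable_fun_le.
Qed.

End RandomMatrices.

Section ClosedConditions.
Set Implicit Arguments.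
Unset Strict Implicit.
Context {R : realType}.

Lemma continuous_sumr (T : topologicalType) n (F : 'I_n -> T -> R) :
  (forall i, continuous (F i)) -> continuous (fun t => \sum_i F i t).
Proof.
by move=> cF; apply: continuous_big => //; exact: add_continuous.
Qed.

Lemma continuous_norm2 (T : topologicalType) n (F : T -> 'cV[R]_n) :
  (forall i, continuous (fun t => F t i 0)) -> continuous (fun t => norm2 (F t)).
Proof.
move=> cF; have cdot : continuous (fun t => dot (F t) (F t)).
  by apply: continuous_sumr => i t; apply: continuousM; exact: cF.
move=> t; apply: (@continuous_comp _ _ _ (fun t => dot (F t) (F t)) Num.sqrt).
  exact: cdot.
exact: sqrt_continuous.
Qed.

Lemma closed_preimage_le (T : topologicalType) (F : T -> R) y :
  continuous F -> closed [set t | F t <= y].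
Proof.
move=> cF; apply: (preimage_closed (f := F) (D := [set z | z <= y])).
  by move=> t _; exact: cF.
exact: closed_le.
Qed.

Lemma closed_preimage_ge (T : topologicalType) (F : T -> R) y :
  continuous F -> closed [set t | y <= F t].
Proof.
move=> cF; apply: (preimage_closed (f := F) (D := [set z | y <= z])).
  by move=> t _; exact: cF.
exact: closed_ge.
Qed.

Lemma closed_conditioned n r (sigma Pmax : R) :
  closed [set A : 'M[R]_(r, n) | conditioned sigma Pmax A].
Proof.
rewrite [X in closed X](_ : _ =
    (\bigcap_u [set A | norm2 (A *m u) <= Pmax * norm2 u]) `&`
    (\bigcap_v [set A | sigma * norm2 v <= norm2 (A^T *m v)])); last first.
  apply/seteqP; split=> A /= [h1 h2].
    by split=> u _; [exact: h1|exact: h2].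
  by split=> u; [exact: (h1 u I)|exact: (h2 u I)].
apply: closedI; apply: closed_bigI => u _.
  apply: closed_preimage_le; apply: continuous_norm2 => i.
  under eq_fun do rewrite mxE; apply: continuous_sumr => j B.
  apply: continuousM; last exact: cst_continuous.
  exact: coord_continuous.
apply: closed_preimage_ge; apply: continuous_norm2 => i.
under eq_fun do rewrite mxE; apply: continuous_sumr => j B.
apply: continuousM; last exact: cst_continuous.
have -> : (fun A : 'M[R]_(r, n) => A^T i j) = (fun A => A j i).
  by apply/funext => A; rewrite mxE.
exact: coord_continuous.
Qed.
End ClosedConditions.

(** * Conditional probabilities and a Chernoff bound *)

Section CondProb.
Set Implicit Arguments.
Unset Strict Implicit.
Context {R : realType} {d : measure_display} {Omega : measurableType d}.
Variable Pr : probability Omega R.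
Implicit Types (A E : set Omega).

Lemma cond_prob_ge_setI (F : set (set Omega)) A (q : R) :
  cond_prob_ge Pr F A q -> forall E, F E -> d.-measurable E ->
  q * fine (Pr E) <= fine (Pr (A `&` E)).
Proof.
move=> [g [mA _ ig gA] [N [mN N0 qg]]] E FE mE.
have igE : Pr.-integrable E (EFin \o g) by exact: integrableS ig.
have mAE : measurable (A `&` E) by exact: measurableI.
rewrite -lee_fin EFinM !fineK ?fin_num_measure// -(gA E FE).
rewrite (negligible_integral mN mE igE N0).
have -> : Pr E = Pr (E `\` N).
  rewrite (measureDI Pr mE mN) -[RHS]adde0; congr (_ + _)%E.
  by apply: (@subset_measure0 _ _ _ Pr _ N) => //; exact: measurableI.
rewrite -integral_cst; last exact: measurableD.
apply: le_integral.
- exact: measurableD.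
- apply: (@integrableS _ _ _ _ setT) => //; first exact: measurableD.
  exact: finite_measure_integrable_cst.
- by apply: integrableS igE => //; exact: measurableD.
- move=> w; rewrite inE => -[_ Nw]; rewrite lee_fin leNgt; apply/negP => gq.
  by apply: Nw; apply: qg => /=; apply/negP; rewrite -ltNge.
Qed.

End CondProb.

(** A sequence of events T, adapted to an increasing family F, where T j has
    conditional probability at least a given F j. The family is described only
    by what is used of it: it absorbs intersections with T j and its
    complement when passing from j to j + 1. *)
Section Chernoff.
Set Implicit Arguments.
Unset Strict Implicit.
Context {R : realType} {d : measure_display} {Omega : measurableType d}.
Variable Pr : probability Omega R.
Variables (F : nat -> set (set Omega)) (T : nat -> set Omega) (a : R).
Hypotheses (a_ge0 : 0 <= a) (a_le1 : a <= 1).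
Hypothesis F_meas : forall j, F j `<=` d.-measurable.
Hypothesis T_meas : forall j, d.-measurable (T j).
Hypothesis F_hit : forall j E, F j E -> F j.+1 (E `&` T j).
Hypothesis F_miss : forall j E, F j E -> F j.+1 (E `\` T j).
Hypothesis hit : forall j E, F j E ->
  a * fine (Pr E) <= fine (Pr (E `&` T j)).

(** Conditional form of the bound on the Laplace transform. Induction on N,
    splitting E according to T j: on the hit part the remaining count must be
    at most l - 1, which contributes a factor expR (- s), and E meets T j in at
    least the proportion a. The real bound l may become negative, in which case
    W is empty. *)
Lemma hit_count_transform (s : R) : 0 <= s -> forall N j E W (l : R), F j E ->
  d.-measurable W -> W `<=` E ->
  (forall w, W w -> \sum_(j <= i < j + N) \1_(T i) w <= l) ->
  fine (Pr W) <= expR (s * l) * (1 - (1 - expR (- s)) * a) ^+ N * fine (Pr E).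
Proof.
move=> s0; have s1 : expR (- s) <= 1 by rewrite expR_le1 oppr_le0.
pose rho := 1 - (1 - expR (- s)) * a; rewrite -/rho.
have rho0 : 0 <= rho.
  have -> : rho = 1 - a + expR (- s) * a by rewrite /rho; ring.
  by rewrite addr_ge0 ?mulr_ge0 ?subr_ge0 ?expR_ge0.
elim=> [|N IH] j E W l FE mW WE Wl.
  rewrite expr0 mulr1.
  have [->|/set0P[w Ww]] := eqVneq W set0.
    by rewrite measure0 mulr_ge0 ?fine_ge0 ?mulr_ge0 ?expR_ge0 ?exprn_ge0.
  have l0 : 0 <= l by have := Wl w Ww; rewrite addn0 big_geq.
  rewrite (@le_trans _ _ (fine (Pr E)))//.
    have mE := F_meas FE.
    by rewrite fine_le ?fin_num_measure ?le_measure ?inE.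
  by rewrite ler_peMl// ?fine_ge0// -expR0 ler_expR mulr_ge0.
have mE := F_meas FE.
have count w : W w -> \1_(T j) w + \sum_(j.+1 <= i < j.+1 + N) \1_(T i) w <= l.
  by move=> /Wl; rewrite big_ltn ?addnS ?ltnS ?leq_addr.
have := IH j.+1 _ (W `&` T j) (l - 1) (F_hit FE) (measurableI _ _ mW (T_meas j)).
have := IH j.+1 _ (W `\` T j) l (F_miss FE) (measurableD mW (T_meas j)).
move=> /(_ (setSD WE)) W_miss /(_ (setSI WE)) W_hit.
have {}W_miss : fine (Pr (W `\` T j)) <=
    expR (s * l) * rho ^+ N * fine (Pr (E `\` T j)).
  by apply: W_miss => w [/count + nTw]; rewrite indicE memNset// add0r.
have {}W_hit : fine (Pr (W `&` T j)) <=
    expR (s * (l - 1)) * rho ^+ N * fine (Pr (E `&` T j)).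
  by apply: W_hit => w [/count + Tw]; rewrite indicE mem_set// lerBrDl.
rewrite (measureDI Pr mW (T_meas j)) fineD ?fin_num_measure//; last 2 first.
- exact: measurableD.
- exact: measurableI.
apply: le_trans (lerD W_miss W_hit) _.
have PE : fine (Pr E) = fine (Pr (E `\` T j)) + fine (Pr (E `&` T j)).
  rewrite (measureDI Pr mE (T_meas j)) fineD ?fin_num_measure//.
    exact: measurableD.
  exact: measurableI.
have -> : expR (s * (l - 1)) = expR (s * l) * expR (- s).
  by rewrite -expRD mulrBr mulr1.
rewrite exprSr mulrA -(mulrA _ rho) (mulrAC _ (expR (- s))) -(mulrA (_ * _) (expR _)).
rewrite -mulrDr ler_wpM2l ?mulr_ge0 ?expR_ge0 ?exprn_ge0//.
have := ler_wpM2l (_ : 0 <= 1 - expR (- s)) (hit FE).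
rewrite subr_ge0 => /(_ s1); rewrite /rho PE; lra.
Qed.

Lemma expRN_le_quadratic (s : R) : 0 <= s -> expR (- s) <= 1 - s + s ^+ 2 / 2.
Proof.
move=> s0.
pose h (t : R) := expR (- t) - (1 - t + t ^+ 2 / 2).
pose dh (t : R) := - expR (- t) - (- 1 + t).
have hd (t : R) : is_derive t 1 h (dh t).
  apply: is_deriveB; apply: is_derive_eq.
    by rewrite mulrN1.
  by rewrite scaler0 scaler0 add0r ![_%:A]mulr1 /GRing.scale/=; field.
have hc : {within `[(0 : R), s], continuous h}.
  apply: continuous_subspaceT => u; apply: differentiable_continuous.
  by apply/derivable1_diffP; case: (hd u).
have [t] := MVT_segment s0 (fun t _ => hd t) hc.
rewrite in_itv/= => /andP[t0 _]; rewrite subr0 => hE.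
have : dh t * s <= 0.
  rewrite mulr_le0_ge0// /dh; have := expR_ge1Dx (- t); lra.
by rewrite -hE /h oppr0 expR0 expr0n/=; lra.
Qed.

(** [hit_count_transform] with s := (a - b) / a, which minimizes the quadratic
    upper bound of the exponent s * b - a * (1 - expR (- s)). *)
Lemma hit_count_chernoff (b : R) k W : F 0%N setT -> 0 < a -> b <= a ->
  d.-measurable W ->
  (forall w, W w -> \sum_(0 <= i < k) \1_(T i) w <= b * k%:R) ->
  fine (Pr W) <= expR (- ((a - b) ^+ 2 / (2 * a) * k%:R)).
Proof.
move=> F0 a0 ba mW Wb; pose s := (a - b) / a.
have s0 : 0 <= s by rewrite divr_ge0// subr_ge0.
have := hit_count_transform s0 (N := k) F0 mW (@subsetT _ _) Wb.
rewrite probability_setT/= mulr1 => /le_trans; apply.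
have -> : - ((a - b) ^+ 2 / (2 * a) * k%:R) =
    s * (b * k%:R) + (- ((s - s ^+ 2 / 2) * a)) *+ k.
  by rewrite -mulr_natr /s; field; rewrite gt_eqF.
rewrite expRD ler_wpM2l ?expR_ge0// -(mulr_natl _ k) expRM_natl.
have rho_ge0 : 0 <= 1 - (1 - expR (- s)) * a.
  have -> : 1 - (1 - expR (- s)) * a = 1 - a + expR (- s) * a by ring.
  by rewrite addr_ge0 ?mulr_ge0 ?subr_ge0 ?expR_ge0.
rewrite lerXn2r ?nnegrE ?expR_ge0// (le_trans _ (expR_ge1Dx _))// lerD2l lerN2.
by rewrite ler_wpM2r//; have := expRN_le_quadratic s0; lra.
Qed.
End Chernoff.

(** * The good iterations as an adapted sequence of events *)

Section Filtration.
Set Implicit Arguments.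
Unset Strict Implicit.
Context {R : realType} {d : measure_display} {Omega : measurableType d}.

(** A sub-sigma-algebra is treated as the measurable sets of a second measurable
    type on the same carrier, so that measurability with respect to it is
    ordinary measurability. *)
Lemma measurable_wrt_entrywise (G : set (set Omega)) a b
    (X : Omega -> 'M[R]_(a, b)) : measurable_wrt <<s G >> X ->
  @entrywise_measurable R _ (g_sigma_algebraType G) a b X.
Proof. by move=> mX i j _ B mB; rewrite setTI; apply: mX; exists i, j, B. Qed.

Variables (n r m : nat) (f : 'cV[R]_n -> R).
Variables (P : nat -> Omega -> 'M[R]_(r, n)) (D : nat -> Omega -> 'I_m -> 'cV[R]_r).
Variable x : nat -> Omega -> 'cV[R]_n.
Hypothesis P_rv : forall k, random_matrix (P k).
Hypothesis D_rv : forall k i, random_matrix (fun w => D k w i).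
Hypothesis x_adapted : forall k, measurable_wrt (past_sigma P D k) (x k).
Hypothesis f_C1 : continuous (gradient f).

Lemma half_events_past k :
  past_events P D k `|` entry_events (P k) `<=` past_events P D k.+1.
Proof.
move=> A [[j /= jk Aj]|AP]; first by exists j => //=; exact: ltnW.
by exists k => //=; left.
Qed.

Lemma past_sigma_half k : past_sigma P D k `<=` half_sigma P D k.
Proof. by apply: sub_sigma_algebra2; exact: subsetUl. Qed.

Lemma half_sigma_past k : half_sigma P D k `<=` past_sigma P D k.+1.
Proof. by apply: sub_sigma_algebra2; exact: half_events_past. Qed.

Lemma past_sigma_measurable k : past_sigma P D k `<=` d.-measurable.
Proof.
apply: smallest_sub; first exact: sigma_algebra_measurable.
by move=> A [j _ [/P_rv|[i _ /D_rv]]].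
Qed.

Lemma entry_events_half k : entry_events (P k) `<=` half_sigma P D k.
Proof. by move=> A AP; apply: sub_sigma_algebra; right. Qed.

Lemma entry_events_direction k i :
  entry_events (fun w => D k w i) `<=` past_sigma P D k.+1.
Proof.
by move=> A AD; apply: sub_sigma_algebra; exists k => //=; right; exists i.
Qed.

Let entrywise := measurable_wrt_entrywise.

Lemma aligned_conditioned_half (eta sigma Pmax : R) k :
  half_sigma P D k
    [set w | aligned_conditioned f eta sigma Pmax (x k w) (P k w)].
Proof.
set G := past_events P D k `|` entry_events (P k).
have mP : @entrywise_measurable R _ (g_sigma_algebraType G) r n (P k).
  by apply: entrywise; exact: entry_events_half.
have mx : @entrywise_measurable R _ (g_sigma_algebraType G) n 1 (x k).
  by apply: entrywise => A /x_adapted; exact: past_sigma_half.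
have mg := continuous_entrywise_measurable mx f_C1.
suff : @measurable _ (g_sigma_algebraType G)
  ([set w | eta * norm2 (gradient f (x k w)) <= norm2 (P k w *m gradient f (x k w))] `&`
   (P k @^-1` [set A | conditioned sigma Pmax A])) by [].
apply: measurableI.
  apply: measurable_ler_set.
    by apply: measurable_funM => //; exact: measurable_norm2.
  by apply: measurable_norm2; exact: entrywise_measurable_mulmx.
rewrite -[X in measurable X]setCK preimage_setC; apply: measurableC.
by apply: measurable_preimage_open => //; apply: closed_openC; exact: closed_conditioned.
Qed.

Lemma has_descent_direction_past (kappa Dmax : R) k :
  past_sigma P D k.+1
    [set w | has_descent_direction f kappa Dmax (x k w) (P k w) (D k w)].
Proof.
set G := past_events P D k.+1.
have mP : @entrywise_measurable R _ (g_sigma_algebraType G) r n (P k).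
  by apply: entrywise => A /entry_events_half; exact: half_sigma_past.
have mx : @entrywise_measurable R _ (g_sigma_algebraType G) n 1 (x k).
  by apply: entrywise => A /x_adapted/past_sigma_half; exact: half_sigma_past.
have mD i : @entrywise_measurable R _ (g_sigma_algebraType G) r 1 (fun w => D k w i).
  by apply: entrywise; exact: entry_events_direction.
have mg := continuous_entrywise_measurable mx f_C1.
have mPg := entrywise_measurable_mulmx mP mg.
have -> : [set w | has_descent_direction f kappa Dmax (x k w) (P k w) (D k w)] =
  (\bigcup_i [set w | kappa * (norm2 (D k w i) * norm2 (P k w *m gradient f (x k w))) <=
     - dot (D k w i) (P k w *m gradient f (x k w))]) `&`
  ((\bigcap_i [set w | Dmax^-1 <= norm2 (D k w i)]) `&`
   (\bigcap_i [set w | norm2 (D k w i) <= Dmax])).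
  apply/seteqP; split=> w /=.
    move=> [[i di] nD]; split; first by exists i.
    by split=> l _ /=; have /andP[] := nD l.
  move=> [[i _ di] [nD1 nD2]]; split; first by exists i.
  by move=> l; apply/andP; split; [exact: nD1|exact: nD2].
suff mm : forall S, @measurable _ (g_sigma_algebraType G) S -> past_sigma P D k.+1 S.
  apply: mm; apply: measurableI; [|apply: measurableI].
  - apply: fin_bigcup_measurable => // i _; apply: measurable_ler_set.
      apply: measurable_funM => //; apply: measurable_funM; exact: measurable_norm2.
    by apply: measurable_funN; exact: measurable_dot.
  - apply: fin_bigcap_measurable => // i _; apply: measurable_ler_set => //.
    exact: measurable_norm2.
  - apply: fin_bigcap_measurable => // i _; apply: measurable_ler_set => //.
    exact: measurable_norm2.
by [].
Qed.

Variable Pr : probability Omega R.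

(** It contains the event that P is well aligned and D a descent set, and still
    has all that the trajectory argument uses. The larger event is taken
    because its membership in the right sigma-algebra is easy to check. *)
Definition good_event (eta sigma Pmax kappa Dmax : R) k : set Omega :=
  [set w | aligned_conditioned f eta sigma Pmax (x k w) (P k w)] `&`
  [set w | has_descent_direction f kappa Dmax (x k w) (P k w) (D k w)].

Lemma good_event_past (eta sigma Pmax kappa Dmax : R) k :
  past_sigma P D k.+1 (good_event eta sigma Pmax kappa Dmax k).
Proof.
apply: (@measurableI _ (g_sigma_algebraType (past_events P D k.+1))).
  by apply: half_sigma_past; exact: aligned_conditioned_half.
exact: has_descent_direction_past.
Qed.

(** Tower property: the alignment part belongs to the intermediate
    sigma-algebra, so it can be joined to E before conditioning the descent
    part. *)
Lemma good_event_hit (eta sigma Pmax kappa Dmax p q : R) :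
  0 < sigma -> 0 < kappa -> 1 < Dmax -> 0 < p ->
  descent_seq Pr f kappa Dmax p P D x ->
  well_aligned_seq Pr f eta sigma Pmax q P D x ->
  forall k E, past_sigma P D k E ->
  p * q * fine (Pr E) <=
    fine (Pr (E `&` good_event eta sigma Pmax kappa Dmax k)).
Proof.
move=> s0 k0 D1 p0 hD hP k E FE.
pose A := [set w | aligned_conditioned f eta sigma Pmax (x k w) (P k w)].
have FEA : half_sigma P D k (E `&` A).
  apply: (@measurableI _
    (g_sigma_algebraType (past_events P D k `|` entry_events (P k)))).
    exact: past_sigma_half.
  exact: aligned_conditioned_half.
have mE : d.-measurable E := past_sigma_measurable FE.
have mEA : d.-measurable (E `&` A).
  by apply: (@past_sigma_measurable k.+1); apply: half_sigma_past.
have mgood : d.-measurable (good_event eta sigma Pmax kappa Dmax k).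
  by apply: (@past_sigma_measurable k.+1); exact: good_event_past.
have mWA : d.-measurable [set w | well_aligned f eta sigma Pmax (x k w) (P k w)].
  by have [g []] := hP k.
have mDS : d.-measurable [set w | descent_set f kappa Dmax (x k w) (P k w) (D k w)].
  by have [g []] := hD k.
have := cond_prob_ge_setI (hP k) FE mE.
have := cond_prob_ge_setI (hD k) FEA mEA.
set S1 := _ `&` (E `&` A); set S2 := _ `&` E => hS1 hS2.
have S2E : fine (Pr S2) <= fine (Pr (E `&` A)).
  rewrite fine_le ?fin_num_measure//; [exact: measurableI|].
  rewrite le_measure ?inE//; first exact: measurableI.
  by move=> w [/(well_aligned_conditioned s0)].
have S1E : fine (Pr S1) <= fine (Pr (E `&` good_event eta sigma Pmax kappa Dmax k)).
  rewrite fine_le ?fin_num_measure//; [exact: measurableI|exact: measurableI|].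
  rewrite le_measure ?inE//; [exact: measurableI|exact: measurableI|].
  by move=> w [/(descent_set_direction k0 D1) ? []].
rewrite (le_trans _ S1E)// (le_trans _ hS1)// -mulrA ler_wpM2l ?(ltW p0)//.
exact: le_trans hS2 S2E.
Qed.

End Filtration.

(** * The complexity bound *)

Theorem theorem3p1 (R : realType) (d : measure_display)
  (Omega : measurableType d) (Pr : probability Omega R)
  (n r m : nat) (hm : (1 <= m)%N) (hr : (1 <= r <= n)%N)
  (f : 'cV[R]_n -> R) (L flow : R) (hL : 0 < L)
  (f_diff : forall x, differentiable f x)
  (f_C1 : continuous (gradient f))
  (f_lip : forall x y,
     norm2 (gradient f x - gradient f y) <= L * norm2 (x - y))
  (f_low : forall x, flow <= f x)
  (x0 : 'cV[R]_n) (alpha_max alpha0 c gamma_dec gamma_inc : R)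
  (hamax : 0 < alpha_max) (ha0 : 0 < alpha0 <= alpha_max) (hc : 0 < c)
  (hdec : 0 < gamma_dec < 1) (hinc : 1 < gamma_inc)
  (P : nat -> Omega -> 'M[R]_(r, n))
  (D : nat -> Omega -> 'I_m -> 'cV[R]_r)
  (x : nat -> Omega -> 'cV[R]_n) (alpha : nat -> Omega -> R)
  (P_rv : forall k, random_matrix (P k))
  (D_rv : forall k i, random_matrix (fun w => D k w i))
  (run : forall w, direct_search f x0 alpha_max alpha0 c gamma_dec gamma_inc
     (P ^~ w) (D ^~ w) (x ^~ w) (alpha ^~ w))
  (* P and D are the only source of randomness *)
  (x_adapted : forall k, measurable_wrt (past_sigma P D k) (x k))
  (eta sigma Pmax kappa Dmax p q : R)
  (heta : 0 < eta) (hsigma : 0 < sigma) (hPmax : 0 < Pmax)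
  (hkappa : 0 < kappa <= 1) (hDmax : 1 < Dmax)
  (hp : 0 < p <= 1) (hq : 0 < q <= 1)
  (D_descent : descent_seq Pr f kappa Dmax p P D x)
  (P_aligned : well_aligned_seq Pr f eta sigma Pmax q P D x) :
  let abar := 2 * kappa * eta / ((L + c) * Pmax ^+ 2 * Dmax ^+ 3) in
  let beta := 2 * Dmax ^+ 2 * (f x0 - flow) / (c * sigma ^+ 2) in
  let mu := log_base gamma_inc gamma_dec^-1 in
  let C := (mu * gamma_dec ^+ 2 + gamma_inc ^+ 2) * gamma_inc ^+ 2 * beta /
           (mu * gamma_dec ^+ 4) in
  let p0 := Num.max (1 / (1 + mu)) (mu / (1 + mu)) in
  p0 < p * q ->
  forall (k : nat) (eps : R), 0 < eps ->
    2 / (p * q - p0) *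
      ((1 - p0) * C / abar ^+ 2 * eps ^- 2 +
       (1 - p0) * log_base gamma_dec
                    (gamma_dec ^+ 2 * abar / (gamma_inc * alpha0) * eps))
      <= k%:R ->
    eps <= Num.min 1 (gamma_inc^-1 * alpha0 / abar) ->
    (* the lower bound on k forces 0 < k; the base value of the minimum is its
       term for j = 0 *)
    let G := fun w =>
      \big[Num.min/norm2 (gradient f (x 0%N w))]_(j < k)
        norm2 (gradient f (x j w)) in
    ((1 - expR (- ((p * q - p0) ^+ 2 / (8 * (p * q)) * k%:R)))%:E
       <= Pr [set w | (G w <= eps)%R])%E.
Proof.
move=> abar beta mu C p0 p0_lt k eps eps0 k_large eps_small.
pose G w := \big[Num.min/norm2 (gradient f (x 0%N w))]_(j < k)
  norm2 (gradient f (x j w)).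
change ((1 - expR (- ((p * q - p0) ^+ 2 / (8 * (p * q)) * k%:R)))%:E <=
  Pr [set w | (G w <= eps)%R])%E.
have /andP[gdec0 gdec1] := hdec; have /andP[a0_gt0 a0_le] := ha0.
have /andP[p_gt0 p_le1] := hp; have /andP[q_gt0 q_le1] := hq.
have /andP[kappa0 _] := hkappa.
have ginc0 : 0 < gamma_inc by exact: lt_trans ltr01 hinc.
have D0 : 0 < Dmax by exact: lt_trans ltr01 hDmax.
have abar0 : 0 < abar.
  by rewrite divr_gt0 ?mulr_gt0 ?exprn_gt0 ?addr_gt0.
have mu0 : 0 < mu by rewrite divr_gt0 ?ln_gt0// invf_gt1.
have mu1 : 0 < 1 + mu by rewrite addr_gt0.
have p0_lt1 : p0 < 1.
  by rewrite gt_max !(ltr_pdivrMr _ _ mu1) !mul1r ltrDl mu0 ltrDr ltr01.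
have p0_ge1 : 1 / (1 + mu) <= p0 by rewrite le_max lexx.
have p0_ge2 : mu / (1 + mu) <= p0 by rewrite le_max lexx orbT.
(* the odds of p0: at most M good iterations per bad one is a proportion p0 *)
pose M := p0 / (1 - p0).
have p0c : 0 < 1 - p0 by rewrite subr_gt0.
have muM : mu <= M.
  rewrite /M ler_pdivlMr//; move: p0_ge2; rewrite ler_pdivrMr//; lra.
have iM : mu^-1 <= M.
  rewrite /M ler_pdivlMr// mulrC ler_pdivrMr//.
  move: p0_ge1; rewrite ler_pdivrMr//; lra.
pose T := good_event f P D x eta sigma Pmax kappa Dmax.
have T_past j : past_sigma P D j.+1 (T j) by exact: good_event_past.
have T_meas j : d.-measurable (T j).
  by apply: (past_sigma_measurable P_rv D_rv (T_past j)).
have small_step : abar * eps <= gamma_inc^-1 * alpha0.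
  move: eps_small; rewrite le_min => /andP[_].
  by rewrite ler_pdivlMr// mulrC.
pose W := ~` [set w | G w <= eps].
have grad_meas j : d.-measurable [set w | norm2 (gradient f (x j w)) <= eps].
  apply: measurable_ler_set => //; apply: measurable_norm2.
  have mx : entrywise_measurable (x j).
    move=> i l _ B mB; rewrite setTI; apply: (past_sigma_measurable P_rv D_rv (k := j)).
    by apply: x_adapted; exists i, l, B.
  exact: continuous_entrywise_measurable mx f_C1.
have G_meas : d.-measurable [set w | G w <= eps].
  rewrite [X in measurable X](_ : _ = [set w | norm2 (gradient f (x 0%N w)) <= eps] `|`
      \bigcup_(j in [set: 'I_k]) [set w | norm2 (gradient f (x j w)) <= eps]).
    apply: measurableU; first exact: grad_meas.
    by apply: fin_bigcup_measurable => // j _; exact: grad_meas.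
  apply/seteqP; split=> w /=.
    rewrite leNgt => /negP GW; apply: contrapT => /not_orP[g0 gj]; apply: GW.
    apply/bigmin_gtP; split=> [|j _]; rewrite ltNge; apply/negP => // gj'.
    by apply: gj; exists j.
  move=> h; rewrite leNgt; apply/negP => /bigmin_gtP[g0 gj].
  case: h => [|[j _ /=]]; first by rewrite leNgt g0.
  by rewrite leNgt gj.
have pq_le1 : p * q <= 1 by rewrite mulr_ile1 ?(ltW p_gt0) ?(ltW q_gt0).
have pq0 : 0 < p * q by exact: mulr_gt0.
(* half of the gap between p0 and p * q absorbs the constant of the upper
   bound, the other half is left for the deviation *)
pose b := (p * q + p0) / 2.
have few_hits w : W w -> \sum_(0 <= j < k) \1_(T j) w <= b * k%:R.
  move=> Ww; have /bigmin_gtP[_ g_large] : eps < G w by rewrite ltNge; exact/negP.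
  have good_ok j : w \in T j ->
      aligned_conditioned f eta sigma Pmax (x j w) (P j w) /\
      has_descent_direction f kappa Dmax (x j w) (P j w) (D j w).
    by rewrite inE => -[].
  have count := @good_iterations_le R n r m f L flow hL f_diff f_lip f_low x0 alpha_max
    alpha0 c gamma_dec gamma_inc ha0 hc hdec hinc _ _ _ _ (run w) eta sigma Pmax
    kappa Dmax eps heta hsigma hPmax kappa0 hDmax eps0 small_step
    (fun j => w \in T j) M k good_ok muM iM (fun j jk => g_large (Ordinal jk) isT).
  have e0 : 0 < abar * eps by exact: mulr_gt0.
  have beta0 : 0 <= beta.
    by rewrite divr_ge0 ?mulr_ge0 ?exprn_ge0 ?subr_ge0 ?f_low ?(ltW D0)
      ?(ltW hc) ?(ltW hsigma).
  have := iteration_budget hdec hinc beta0 e0 a0_gt0 (erefl mu).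
  have -> : (1 + mu^-1) * (gamma_inc ^+ 2 / (gamma_dec ^+ 2 * (abar * eps) ^+ 2) * beta) =
      (1 + mu^-1) * (2 * Dmax ^+ 2 * gamma_inc ^+ 2 /
        (c * sigma ^+ 2 * gamma_dec ^+ 2 * (abar * eps) ^+ 2) * (f x0 - flow)).
    by rewrite /beta; field; rewrite !gt_eqF.
  rewrite -/C.
  set S := C / (abar * eps) ^+ 2 + _ => budget.
  have kS : (1 - p0) * S <= (p * q - p0) / 2 * k%:R.
    move: k_large; rewrite (_ : (1 - p0) * C / abar ^+ 2 * eps ^- 2 +
      (1 - p0) * _ = (1 - p0) * S); last first.
      rewrite /S (_ : gamma_dec ^+ 2 * abar / (gamma_inc * alpha0) * eps =
        gamma_dec ^+ 2 * (abar * eps) / (gamma_inc * alpha0)); last by ring.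
      by field; rewrite !gt_eqF.
    have h0 : 0 < (p * q - p0) / 2 by rewrite divr_gt0 ?subr_gt0.
    rewrite -(ler_pM2l h0) mulrA.
    rewrite (_ : (p * q - p0) / 2 * (2 / (p * q - p0)) = 1) ?mul1r//.
    by field; rewrite gt_eqF ?subr_gt0.
  have hits : (\sum_(0 <= j < k) (w \in T j)%:R) * (1 + M) <= M * k%:R + S.
    by move: count budget; rewrite -/abar -/mu; lra.
  have ME : M * (1 - p0) = p0 by rewrite /M divfK// gt_eqF.
  under eq_bigr do rewrite indicE.
  have := ler_wpM2r (ltW p0c) hits.
  set N := \sum_(0 <= j < k) _.
  have -> : N * (1 + M) * (1 - p0) = N * (1 - p0 + M * (1 - p0)) by ring.
  have -> : (M * k%:R + S) * (1 - p0) = M * (1 - p0) * k%:R + (1 - p0) * S by ring.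
  rewrite ME /b; move: kS; lra.
have bpq : b <= p * q by rewrite /b; lra.
have F_hit j E : past_sigma P D j E -> past_sigma P D j.+1 (E `&` T j).
  move=> FE; apply: (@measurableI _ (g_sigma_algebraType (past_events P D j.+1)));
    last exact: T_past.
  by apply: half_sigma_past; exact: past_sigma_half.
have F_miss j E : past_sigma P D j E -> past_sigma P D j.+1 (E `\` T j).
  move=> FE; apply: (@measurableD _ (g_sigma_algebraType (past_events P D j.+1)));
    last exact: T_past.
  by apply: half_sigma_past; exact: past_sigma_half.
have hit := good_event_hit P_rv D_rv x_adapted f_C1 hsigma kappa0 hDmax p_gt0
  D_descent P_aligned.
have F0 : past_sigma P D 0 setT.
  exact: (@measurableT _ (g_sigma_algebraType (past_events P D 0))).
have := hit_count_chernoff (ltW pq0) pq_le1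
  (past_sigma_measurable P_rv D_rv) T_meas F_hit F_miss hit F0 pq0 bpq
  (measurableC G_meas) few_hits.
rewrite probability_setC// => tail.
have -> : (p * q - p0) ^+ 2 / (8 * (p * q)) = (p * q - b) ^+ 2 / (2 * (p * q)).
  by rewrite /b; field; rewrite !gt_eqF.
move: tail; rewrite -[Pr [set w | G w <= eps]]fineK ?fin_num_measure// lee_fin.
rewrite fineB ?fin_num_measure//=; lra.
Qed.
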